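(* For all integers $q \ge d \ge c \ge 1$, $B(q,d,c) \le p(q,d,c)$, where $p(q,d,c)$ is the smallest prime number that is at least $\left\lceil \frac{q-c+1}{d-c+1}\right\rceil$. That is, every $f:\binom{[q]}{d}\to[c]$ has a $p(q,d,c)$-cover.
   Context: $\binom{[q]}{d}$ denotes the family of $d$-element subsets of $[q]=\{1,\dots,q\}$. A function $f:\binom{[q]}{d}\to[c]$ has a $t$-cover if there exist $S_1,\dots,S_t\in\binom{[q]}{d}$ (not necessarily distinct) with $S_1\cup\dots\cup S_t=[q]$ and $f(S_1)=\dots=f(S_t)$. $B(q,d,c)$ is the minimum $t$ such that every $f:\binom{[q]}{d}\to[c]$ has a $t$-cover. *)

(* Defs.v *)
From mathcomp Require Import all_boot.
Set Implicit Arguments. Unset Strict Implicit. Unset Printing Implicit Defensive.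

Definition dsubset (q d : nat) := {S : {set 'I_q} | #|S| == d}.

Definition has_cover (q d c t : nat) (f : dsubset q d -> 'I_c) : Prop :=
  exists (S : 'I_t -> dsubset q d),
    \bigcup_(i < t) val (S i) = [set: 'I_q] /\
    exists col : 'I_c, forall i : 'I_t, f (S i) = col.

Arguments has_cover : clear implicits.

Definition ceil_div (a b : nat) : nat := (a + b - 1) %/ b.

Definition is_least_prime_geq (p n : nat) : Prop :=
  prime p /\ n <= p /\ forall r, prime r -> n <= r -> p <= r.

(* Main.v *)
Require Import Defs.
From mathcomp Require Import all_boot all_algebra.
From mathcomp Require Import zify ring.
Set Implicit Arguments. Unset Strict Implicit. Unset Printing Implicit Defensive.
Import GRing.Theory.
Local Open Scope ring_scope.

(* For a colouring without a [p]-cover, label [p - 1] copies of each of the [q] points by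
   elements of [Z_p] or nothing. Such a partial labelling [X] gives sets
   [parts X t] (points having a copy labelled [t]) with empty intersection. If some part
   contains the complement of a [d]-set, record for each [t] the colours of the
   [d]-sets with complement inside [parts X t]; since there is no cover, no colour
   occurs for all [t]. Otherwise record the parts themselves, which then have fewer
   than [q - d] elements. Either record grows with [X] and is not fixed by
   any nonzero rotation of [Z_p] ([p] is prime), so its total size gives a monotone level
   between [1] and [p (q - d - 1) + c (p - 1)], and choosing orbit representatives
   gives a [Z_p]-equivariant label that is constant along comparable vectors of
   equal level. By the [Z_p]-Tucker lemma the number [q (p - 1)] of coordinates is at
   most the maximal level, contradicting the choice of [p].

   The Tucker lemma is Dold's theorem at the chain level. In the order complex of the
   signed vectors one builds chains [h_j] of dimension [j] with boundary
   [(1 - g) h_(j-1)] or [N h_(j-1)], [N = \sum_a g^a], alternately, by coning off with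
   a new coordinate. On sequences in [Z_p] there are normalized cochains satisfying
   the dual relations. Pulled back along the label, they satisfy
   [<N phi_j, h_j> = 1] mod [p] for all [j]; but in top dimension every sequence of labels has
   two equal neighbours when there are fewer levels than coordinates. *)

(** * Simplicial cochains on sequences *)

Section Coboundary.
Variable R : comNzRingType.

(** The augmented simplicial coboundary: on a one-entry sequence it is the value of [phi] at the
    empty sequence. *)
Fixpoint delta (T : Type) (phi : seq T -> R) (s : seq T) : R :=
  if s is x :: s' then phi s' - delta (fun t => phi (x :: t)) s' else 0.

Lemma eq_delta (T : Type) (phi psi : seq T -> R) s :
  (forall t, (size t).+1 = size s -> phi t = psi t) ->
  delta phi s = delta psi s.
Proof.
elim: s phi psi => //= x s IH phi psi H; rewrite H //; congr (_ - _).
by apply: IH => t st; apply: H; rewrite /= st.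
Qed.

Lemma delta0 (T : Type) (s : seq T) : delta (fun _ => 0) s = 0.
Proof. by elim: s => //= x s ->; rewrite subrr. Qed.

Lemma deltaD (T : Type) (phi psi : seq T -> R) s :
  delta (fun t => phi t + psi t) s = delta phi s + delta psi s.
Proof.
elim: s phi psi => [|x s IH] phi psi /=; first by rewrite addr0.
by rewrite IH opprD addrACA.
Qed.

Lemma deltaN (T : Type) (phi : seq T -> R) s :
  delta (fun t => - phi t) s = - delta phi s.
Proof.
by elim: s phi => [|x s IH] phi /=; rewrite ?oppr0 // IH opprB opprK addrC.
Qed.

Lemma deltaB (T : Type) (phi psi : seq T -> R) s :
  delta (fun t => phi t - psi t) s = delta phi s - delta psi s.
Proof. by rewrite deltaD deltaN. Qed.

Lemma delta_sum (T : Type) (I : Type) (r : seq I) (phi : I -> seq T -> R) s :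
  delta (fun t => \sum_(i <- r) phi i t) s = \sum_(i <- r) delta (phi i) s.
Proof.
elim: r => [|i r IH].
  rewrite big_nil -[RHS](delta0 s); apply: eq_delta => t _.
  by rewrite big_nil.
rewrite big_cons -IH -deltaD; apply: eq_delta => t _.
by rewrite big_cons.
Qed.

Lemma delta_map (T U : Type) (h : T -> U) (phi : seq U -> R) s :
  delta (fun t => phi (map h t)) s = delta phi (map h s).
Proof.
elim: s phi => //= x s IH phi; congr (_ - _).
exact: IH (fun t => phi (h x :: t)).
Qed.

Lemma delta_delta (T : Type) (phi : seq T -> R) s : delta (delta phi) s = 0.
Proof.
elim: s phi => //= x s IH phi.
by rewrite deltaB IH subr0 subrr.
Qed.

Definition degenerate (T : eqType) (s : seq T) :=
  ~~ sorted (fun x y => x != y) s.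

Definition normalized (T : eqType) (phi : seq T -> R) :=
  forall s, degenerate s -> phi s = 0.

(** Deleting either of two equal neighbours gives the same sequence with opposite signs, and every
    other deletion keeps the repetition. *)
Lemma normalized_delta (T : eqType) (phi : seq T -> R) :
  normalized phi -> normalized (delta phi).
Proof.
move=> nphi s; elim: s phi nphi => // x [|y s] IH phi nphi //=.
rewrite /degenerate /= negb_and negbK => /orP[/eqP <-|dys].
  rewrite opprB addrCA subrr addr0 (@eq_delta _ _ (fun _ => 0)) ?delta0 // => t _.
  by apply: nphi; rewrite /degenerate /= eqxx.
rewrite nphi // sub0r (_ : _ - _ = 0) ?oppr0 //.
apply: (IH (fun t => phi (x :: t))) => // t dt; apply: nphi.
by case: t dt => // z t; rewrite /degenerate /= negb_and orbC => ->.
Qed.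

End Coboundary.

(** * Chains under a cyclic action *)

Section Cyclic.
Variable p' : nat.
Notation G := 'I_p'.+2.
Variable (T : Type) (act : G -> T -> T).

(* Here [1] generates the group [Z_p], and the same [Z_p] serves as coefficient ring. *)
Definition twist (a : G) (phi : seq T -> G) s := phi (map (act a) s).
Definition norm_op (phi : seq T -> G) s := \sum_a twist a phi s.
Definition diff_op (phi : seq T -> G) s := phi s - twist 1 phi s.
Definition alt_op j := if odd j then diff_op else norm_op.

Lemma delta_alt_op j phi s : delta (alt_op j phi) s = alt_op j (delta phi) s.
Proof.
rewrite /alt_op; case: odd.
  by rewrite /diff_op deltaB /twist delta_map.
by rewrite /norm_op delta_sum; apply: eq_bigr => a _; rewrite /twist delta_map.
Qed.

Hypothesis act0 : forall x, act 0 x = x.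
Hypothesis actD : forall a b x, act a (act b x) = act (a + b) x.

Lemma twistD a b phi s : twist a phi (map (act b) s) = twist (a + b) phi s.
Proof. by rewrite /twist -map_comp; congr phi; apply: eq_map => x /=; rewrite actD. Qed.

Lemma twist0 phi s : twist 0 phi s = phi s.
Proof. by rewrite /twist (eq_map act0) map_id. Qed.

Lemma norm_twist b phi s : norm_op phi (map (act b) s) = norm_op phi s.
Proof.
rewrite /norm_op [RHS](reindex_inj (addIr b)) /=.
by apply: eq_bigr => a _; rewrite twistD.
Qed.

Lemma alt_op_alt_op j phi s : alt_op j (alt_op j.+1 phi) s = 0.
Proof.
rewrite /alt_op /=; case: odd => /=.
  by rewrite /diff_op /twist norm_twist subrr.
rewrite {1}/norm_op /twist /diff_op big_split /= sumrN.
rewrite [X in _ - X](_ : _ = norm_op phi s) ?subrr //.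
rewrite -(norm_twist 1 phi) /norm_op; apply: eq_bigr => a _.
by rewrite !twistD addrC.
Qed.

End Cyclic.

(** * Normalized cochains on sequences in [Z_p] *)

Section Cochains.
Variable p' : nat.
Notation G := 'I_p'.+2.
Let tr (a x : G) : G := x + a.

Let tr0 x : tr 0 x = x. Proof. exact: addr0. Qed.
Let trD a b x : tr a (tr b x) = tr (a + b) x.
Proof. by rewrite /tr -addrA (addrC a). Qed.

(* For odd [j] the sum solves [(1 - g) phi = delta (cochain j.-1)] along each orbit,
   starting from the sequence with head [0]. *)
Fixpoint cochain j : seq G -> G :=
  if j is j'.+1 then fun s =>
    if odd j then
      - \sum_(t : G | (t < @head G 0%R s)%N) twist tr (t - head 0 s) (delta (cochain j')) s
    else (head 0 s == 0)%:R * delta (cochain j') s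
  else fun s => (s == [:: 0])%:R.

Lemma head_tr a x (s : seq G) : head 0 (map (tr a) (x :: s)) = x + a.
Proof. by []. Qed.

Lemma cochain0 x : norm_op tr (cochain 0) [:: x] = 1.
Proof.
rewrite /norm_op (bigD1 (- x)) //= /twist /= /tr subrr eqxx big1 ?addr0 // => a.
by rewrite eqseq_cons andbT addrC addr_eq0 => /negPf ->.
Qed.

Lemma val_succ (x : G) : x + 1 != 0 -> (x + 1 : G) = x.+1 :> nat.
Proof.
move=> nz; have := ltn_ord x; rewrite leq_eqVlt => /orP[/eqP e|lt].
  by case/eqP: nz; apply: val_inj; rewrite /= (modn_small (isT : (1 < p'.+2)%N)) addn1 e modnn.
by rewrite /= !modn_small // addn1.
Qed.

Lemma val_last (x : G) : x + 1 = 0 -> (x : nat) = p'.+1.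
Proof.
move/(congr1 (@nat_of_ord _)) => /=; rewrite (modn_small (isT : (1 < p'.+2)%N)) addn1.
have := ltn_ord x; rewrite leq_eqVlt => /orP[/eqP [] //|lt].
by rewrite modn_small.
Qed.

(** Each equation is solvable because the operator of index [j] kills [delta (cochain j)]: by
    induction this is [delta_delta], and for [j = 0] the norm of [cochain 0] is constantly [1]. *)
Lemma cochain_rec j s : size s = j.+2 ->
  alt_op tr j.+1 (cochain j.+1) s = delta (cochain j) s.
Proof.
move: j s.
suff step j : (forall s, size s = j.+2 -> alt_op tr j (delta (cochain j)) s = 0) ->
    forall s, size s = j.+2 -> alt_op tr j.+1 (cochain j.+1) s = delta (cochain j) s.
  elim=> [|j IH]; apply: step => s ss; rewrite -delta_alt_op.
    rewrite (@eq_delta _ _ _ (fun _ => 1)).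
      by case: s ss => // x [|y []] //= _; rewrite !subr0 subrr.
    case=> [|x []]; rewrite ss //.
    by rewrite /alt_op /= cochain0.
  rewrite -[RHS](delta_delta (cochain j) s); apply: eq_delta => t st.
  by apply: IH; move: st; rewrite ss => -[].
set psi := delta _; move=> H [//|x s] ss; move: H; rewrite /alt_op /=.
(* For odd [j], [psi] is rotation invariant along the orbit, and exactly one rotation moves the head
   to [0]. *)
case: (odd j) => /= H.
  have inv a : twist tr a psi (x :: s) = psi (x :: s).
    rewrite -[a]natr_Zp; elim: (a : nat) => [|m IH]; first exact: twist0.
    rewrite -IH -natr1 addrC -(twistD trD); apply/esym/eqP.
    by rewrite -subr_eq0; apply/eqP/(H (map _ (x :: s))); rewrite size_map.
  rewrite /norm_op (bigD1 (- x)) // big1 => [|a].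
    rewrite [LHS]addr0 /twist head_tr subrr eqxx mul1r; exact: inv.
  by rewrite andTb -addr_eq0 addrC /twist head_tr => /negPf ->; rewrite mul0r.
have {}H := H _ ss.
rewrite /diff_op {2}/twist -/psi head_tr opprK.
under [X in _ + X]eq_bigr => t _ do rewrite twistD //.
have E (t : G) : t - (x + 1) + 1 = t - x by rewrite opprD addrA subrK.
under [X in _ + X]eq_bigr => t _ do rewrite E.
have last : psi (x :: s) = twist tr (x - x) psi (x :: s) by rewrite subrr twist0.
(* From head [x] to [x + 1] the sum gains the term [t = x], except at the wrap-around to [0], where
   it becomes empty and the vanishing norm of [psi] supplies the value. *)
have [x1|x1] := eqVneq (x + 1) 0.
  rewrite x1 [X in _ + X]big1 // addr0 last.
  apply/eqP; rewrite eq_sym -addr_eq0; apply/eqP; rewrite -[RHS]H /norm_op.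
  rewrite [RHS](reindex_inj (addIr (- x))) /= [RHS](bigD1 x) //=; congr (_ + _).
  apply: eq_bigl => t; rewrite -val_eqE /=.
  by have := ltn_ord t; have := val_last x1; lia.
have lt_succ (t : G) : (t < (x + 1)%R)%N = (t <= x)%N by rewrite val_succ.
rewrite (eq_bigl _ _ lt_succ) addrC (bigD1 x) //= -last -addrA -[RHS]addr0.
congr (_ + _); apply/eqP; rewrite subr_eq0; apply/eqP.
by apply: eq_bigl => t; rewrite [RHS]ltn_neqAle andbC.
Qed.

Lemma degenerate_tr a s : degenerate (map (tr a) s) = degenerate s.
Proof.
rewrite /degenerate sorted_map; congr (~~ _).
by apply: eq_sorted => x y /=; rewrite /tr (inj_eq (addIr a)).
Qed.

Lemma normalized_cochain j : normalized (cochain j).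
Proof.
elim: j => [|j IH] s ds /=.
  by case: eqP ds => // ->.
have {}IH := normalized_delta IH; case: ifP => _; last by rewrite IH ?mulr0.
by rewrite big1 ?oppr0 // => a _; rewrite /twist IH // degenerate_tr.
Qed.
End Cochains.

(** * Signed vectors and cones over a new coordinate *)

Section SignVectors.
Variables (p' n : nat).
Notation G := 'I_p'.+2.
Definition signvec := {ffun 'I_n -> option G}.
Implicit Types (X Y : signvec) (s : seq signvec) (phi : seq signvec -> G).

Definition sv0 : signvec := [ffun => None].
Definition sv_act (a : G) X : signvec := [ffun i => omap (+%R^~ a) (X i)].
Definition sv_le X Y := [forall i, (X i == None) || (X i == Y i)].
Definition sv_put (j : nat) X : signvec :=
  [ffun i : 'I_n => if i == j :> nat then Some 0 else X i].
Definition sv_below (j : nat) X := [forall i : 'I_n, (j <= i)%N ==> (X i == None)].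

Lemma sv_actD a b X : sv_act a (sv_act b X) = sv_act (a + b) X.
Proof.
apply/ffunP => i; rewrite !ffunE; case: (X i) => //= x.
by rewrite -addrA (addrC a).
Qed.

Lemma sv_act_eq0 a X : (sv_act a X == sv0) = (X == sv0).
Proof.
apply/eqP/eqP => [|->]; last by apply/ffunP => i; rewrite !ffunE.
move/ffunP => H; apply/ffunP => i; move: (H i); rewrite !ffunE.
by case: (X i).
Qed.

Lemma sv_leP X Y : reflect (forall i, X i = None \/ X i = Y i) (sv_le X Y).
Proof.
apply: (iffP forallP) => H i; first by case/orP: (H i) => /eqP; [left|right].
by case: (H i) => ->; rewrite eqxx ?orbT.
Qed.

Lemma sv_belowP j X :
  reflect (forall i : 'I_n, (j <= i)%N -> X i = None) (sv_below j X).
Proof.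
apply: (iffP forallP) => H i.
  by move=> ji; move: (H i); rewrite ji => /eqP.
by apply/implyP => /H ->.
Qed.

Lemma sv_le0 X : sv_le sv0 X.
Proof. by apply/sv_leP => i; left; rewrite ffunE. Qed.

Lemma sv_le_act a X Y : sv_le X Y -> sv_le (sv_act a X) (sv_act a Y).
Proof.
by move/sv_leP => H; apply/sv_leP => i; rewrite !ffunE; case: (H i) => ->; [left|right].
Qed.

Lemma sv_below_act j a X : sv_below j X -> sv_below j (sv_act a X).
Proof. by move/sv_belowP => H; apply/sv_belowP => i /H; rewrite ffunE => ->. Qed.

Lemma sv_le_put j X Y : sv_le X Y -> sv_le (sv_put j X) (sv_put j Y).
Proof.
move/sv_leP => H; apply/sv_leP => i; rewrite !ffunE.
by case: eqP => _; [right | apply: H].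
Qed.

Lemma sv_le_put_self j X : sv_below j X -> sv_le X (sv_put j X).
Proof.
move/sv_belowP => H; apply/sv_leP => i; rewrite !ffunE.
by case: eqP => e; [left; rewrite H ?e | right].
Qed.

Lemma sv_below_put j X : sv_below j X -> sv_below j.+1 (sv_put j X).
Proof.
move/sv_belowP => H; apply/sv_belowP => i ji; rewrite ffunE.
by rewrite gtn_eqF // H // ltnW.
Qed.

Lemma sv_belowS j X : sv_below j X -> sv_below j.+1 X.
Proof. by move/sv_belowP => H; apply/sv_belowP => i /ltnW /H. Qed.

Lemma sv_put_neq0 j X : (j < n)%N -> sv_put j X != sv0.
Proof.
move=> jn; apply/eqP => /ffunP /(_ (Ordinal jn)).
by rewrite !ffunE eqxx.
Qed.

Definition good_sv j X := (X != sv0) && sv_below j X.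
(** Only good sequences of size [j.+1] matter to [chain_eval j]; they avoid [sv0], where a label
    cannot be equivariant. *)
Definition good j s := [&& size s == j, path sv_le sv0 s & all (good_sv j) s].

(* [cone] and [prism] are dual to the two halves of the contraction
   [X <= sv_put j X >= sv_put j sv0] of the vectors supported below [j]. *)
Definition cone j phi s := phi (sv_put j sv0 :: map (sv_put j) s).

Fixpoint prism j phi s : G :=
  if s is X :: s' then
    phi (X :: map (sv_put j) s) - prism j (fun t => phi (X :: t)) s'
  else 0.

Definition filling j phi s := cone j phi s - prism j phi s.

Lemma prismB j phi psi s :
  prism j (fun t => phi t - psi t) s = prism j phi s - prism j psi s.
Proof.
elim: s phi psi => [|X s IH] phi psi /=; first by rewrite subrr.
by rewrite IH !opprB addrACA [RHS]addrACA; congr (_ + _); rewrite addrC.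
Qed.

Lemma prism_delta j phi s :
  prism j (delta phi) s + delta (prism j phi) s = phi (map (sv_put j) s) - phi s.
Proof.
elim: s phi => [|X s IH] phi /=; first by rewrite addr0 subrr.
rewrite prismB deltaB.
set psi := fun t => phi (X :: t).
have -> : prism j (delta psi) s
    = psi (map (sv_put j) s) - psi s - delta (prism j psi) s.
  by rewrite -IH addrK.
rewrite (delta_map (sv_put j) (fun t => phi (X :: sv_put j X :: t))) /psi.
ring.
Qed.

(** The homotopy [cone] yields the pullback along [sv_put j], and [prism] yields that pullback minus
    the identity; their difference leaves the identity. *)
Lemma filling_delta j phi s : filling j (delta phi) s + delta (filling j phi) s = phi s.
Proof.
have H := prism_delta j phi s.
rewrite /filling deltaB /cone /= (delta_map (sv_put j) (fun t => phi (_ :: t))).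
rewrite -[phi s](subKr (phi (map (sv_put j) s))) -H; ring.
Qed.

Lemma path_put j X s : path sv_le X s -> path sv_le (sv_put j X) (map (sv_put j) s).
Proof.
elim: s X => //= Y s IH X /andP[XY /IH ->]; rewrite andbT.
exact: sv_le_put.
Qed.

Lemma good_sv_put j s : (j < n)%N -> all (good_sv j) s ->
  all (good_sv j.+1) (map (sv_put j) s).
Proof.
move=> jn; rewrite all_map; apply: sub_all => X /andP[_ bX] /=.
by rewrite /good_sv sv_put_neq0 // sv_below_put.
Qed.

(** The sequences met follow [s] up to some entry [Y] and continue with the images under [sv_put j]
    from [Y] onwards; they increase since [Y <= sv_put j Y]. *)
Lemma eq_prism j X phi psi s : (j < n)%N -> path sv_le X s -> all (good_sv j) s ->
  (forall t, size t = (size s).+1 -> path sv_le X t -> all (good_sv j.+1) t ->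
    phi t = psi t) ->
  prism j phi s = prism j psi s.
Proof.
move=> jn; elim: s X phi psi => //= Y s IH X phi psi /andP[XY Ys] /andP[gY gs] H.
have gY' : good_sv j.+1 Y.
  by case/andP: gY => nY bY; rewrite /good_sv nY sv_belowS.
congr (_ - _).
  apply: H => /=; first by rewrite size_map.
    by rewrite XY path_put // sv_le_put_self //; case/andP: gY.
  by rewrite gY'; apply: (@good_sv_put j (Y :: s)) => //=; rewrite gY.
apply: (IH Y) => // t st Yt gt; apply: H => /=; first by rewrite st.
  by rewrite XY.
by rewrite gY'.
Qed.

Lemma eq_filling j phi psi s : (j < n)%N -> good j s ->
  (forall t, good j.+1 t -> phi t = psi t) -> filling j phi s = filling j psi s.
Proof.
move=> jn /and3P[/eqP ss ps gs] H; congr (_ - _).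
  apply: H; rewrite /good /= size_map ss eqxx sv_le0 path_put //=.
  rewrite good_sv_put // andbT /good_sv sv_put_neq0 // sv_below_put //.
  by apply/sv_belowP => i _; rewrite ffunE.
apply: (eq_prism jn ps gs) => t st pt gt; apply: H.
by rewrite /good st ss eqxx pt.
Qed.

Lemma good_act j a s : good j s -> good j (map (sv_act a) s).
Proof.
move=> /and3P[ss ps gs]; rewrite /good size_map ss /=; apply/andP; split.
  have <- : sv_act a sv0 = sv0 by apply/ffunP => i; rewrite !ffunE.
  by apply: homo_path ps => X Y; apply: sv_le_act.
rewrite all_map; apply: sub_all gs => X /andP[nX bX] /=.
by rewrite /good_sv sv_act_eq0 nX sv_below_act.
Qed.

Lemma eq_alt_op j k phi psi s : good j s ->
  (forall t, good j t -> phi t = psi t) ->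
  alt_op sv_act k phi s = alt_op sv_act k psi s.
Proof.
move=> gs H; rewrite /alt_op; case: odd.
  by rewrite /diff_op /twist !H ?good_act.
by apply: eq_bigr => a _; rewrite /twist H // good_act.
Qed.

(* The functional [chain_eval j] is integration over a [j]-chain [h_j] with
   boundary [(1 - g) h_(j-1)] for odd [j] and [(\sum_a g^a) h_(j-1)] for even [j > 0]. *)
Fixpoint chain_eval j phi : G :=
  if j is j'.+1 then chain_eval j' (alt_op sv_act j (filling j phi))
  else phi [:: sv_put 0 sv0].

Lemma good1 : (0 < n)%N -> good 1 [:: sv_put 0 sv0].
Proof.
move=> n0; rewrite /good /= sv_le0 /good_sv sv_put_neq0 // sv_below_put //.
by apply/sv_belowP => i _; rewrite ffunE.
Qed.

Lemma eq_chain_eval j phi psi : (j < n)%N ->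
  (forall s, good j.+1 s -> phi s = psi s) -> chain_eval j phi = chain_eval j psi.
Proof.
elim: j phi psi => [|j IH] phi psi jn H /=; first exact/H/good1.
apply: IH => [|s gs]; first exact: ltnW.
by apply: (eq_alt_op _ gs) => t gt; apply: eq_filling.
Qed.

Lemma alt_opB k phi psi s :
  alt_op sv_act k (fun t => phi t - psi t) s = alt_op sv_act k phi s - alt_op sv_act k psi s.
Proof.
rewrite /alt_op; case: odd; first by rewrite /diff_op /twist; ring.
by rewrite /norm_op -sumrB.
Qed.

Lemma fillingB j phi psi s :
  filling j (fun t => phi t - psi t) s = filling j phi s - filling j psi s.
Proof. by rewrite /filling prismB /cone; ring. Qed.

Lemma chain_evalB j phi psi : (j < n)%N ->
  chain_eval j (fun s => phi s - psi s) = chain_eval j phi - chain_eval j psi.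
Proof.
elim: j phi psi => //= j IH phi psi jn; rewrite -IH; last exact: ltnW.
apply: eq_chain_eval => [|s gs]; first exact: ltnW.
by rewrite -alt_opB; apply: (eq_alt_op _ gs) => t _; rewrite fillingB.
Qed.

Lemma chain_eval0 j : (j < n)%N -> chain_eval j (fun _ => 0) = 0.
Proof.
move=> jn; rewrite -[RHS](subrr (chain_eval j (fun _ => 0))) -chain_evalB //.
by apply: eq_chain_eval => // s _; rewrite subrr.
Qed.

Lemma chain_evalD j phi psi : (j < n)%N ->
  chain_eval j (fun s => phi s + psi s) = chain_eval j phi + chain_eval j psi.
Proof.
move=> jn; apply/eqP; rewrite -subr_eq -chain_evalB //; apply/eqP.
by apply: eq_chain_eval => // s _; rewrite addrK.
Qed.

Lemma chain_eval_sum (I : Type) (r : seq I) j (phi : I -> seq signvec -> G) : (j < n)%N ->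
  chain_eval j (fun s => \sum_(i <- r) phi i s) = \sum_(i <- r) chain_eval j (phi i).
Proof.
move=> jn; elim: r => [|i r IH].
  rewrite big_nil -[RHS](chain_eval0 jn).
  by apply: eq_chain_eval => // s _; rewrite big_nil.
rewrite big_cons -IH -chain_evalD //.
by apply: eq_chain_eval => // s _; rewrite big_cons.
Qed.

Lemma chain_eval_filling j phi : (j < n)%N ->
  chain_eval j (delta (alt_op sv_act j.+1 (filling j.+1 phi))) = 0 ->
  chain_eval j.+1 (delta phi) = chain_eval j (alt_op sv_act j.+1 phi).
Proof.
move=> jn H; rewrite -[RHS]subr0 -H -chain_evalB //=.
apply: eq_chain_eval => // s gs.
rewrite delta_alt_op -alt_opB; apply: (eq_alt_op _ gs) => t _.
by rewrite -(filling_delta j.+1 phi t) addrK.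
Qed.

(** Stokes' formula for [h_(j+1)]. The error term left by [filling_delta] vanishes by induction,
    since two consecutive operators compose to [0]. *)
Lemma chain_eval_delta j phi : (j < n)%N ->
  chain_eval j.+1 (delta phi) = chain_eval j (alt_op sv_act j.+1 phi).
Proof.
elim: j phi => [|j IH] phi jn; apply: chain_eval_filling => //.
  (* [h_0] is a single point, so the coboundary is the value at the empty sequence, where [diff_op]
     vanishes. *)
  by rewrite /= /alt_op /= /diff_op /twist /= !subrr.
have jn' := ltnW jn; rewrite IH // -[RHS](chain_eval0 jn').
by apply: eq_chain_eval => // s _; rewrite alt_op_alt_op //; apply: sv_actD.
Qed.

End SignVectors.

(** * A [Z_p]-Tucker lemma *)

Section Tucker.
Variables (p' n : nat).
Notation G := 'I_p'.+2.
Notation signvec := (signvec p' n).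
Notation sv0 := (sv0 p' n).
Variables (level : signvec -> nat) (label : signvec -> G) (D : nat).
Hypothesis level_mono :
  forall X Y, X != sv0 -> sv_le X Y -> (level X <= level Y)%N.
Hypothesis label_level :
  forall X Y, X != sv0 -> sv_le X Y -> level X = level Y -> label X = label Y.
Hypothesis label_act : forall a X, X != sv0 -> label (sv_act a X) = label X + a.
Hypothesis level_gt0 : forall X, X != sv0 -> (0 < level X)%N.
Hypothesis level_leD : forall X, X != sv0 -> (level X <= D)%N.

Let tr (a x : G) : G := x + a.
Let pull j s := cochain j (map label s).

Lemma twist_pull j k a s : good k s ->
  twist (@sv_act p' n) a (pull j) s = twist tr a (cochain j) (map label s).
Proof.
move=> /and3P[_ _ gs]; rewrite /twist /pull -!map_comp; congr (cochain _ _).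
by apply/eq_in_map => X /(allP gs) /andP[nX _] /=; rewrite label_act.
Qed.

Lemma alt_op_pull j k l s : good k s ->
  alt_op (@sv_act p' n) l (pull j) s = alt_op tr l (cochain j) (map label s).
Proof.
move=> gs; rewrite /alt_op; case: odd; first by rewrite /diff_op (twist_pull _ _ gs).
by apply: eq_bigr => a _; apply: twist_pull gs.
Qed.

Lemma pull_rec j s : good j.+2 s ->
  alt_op (@sv_act p' n) j.+1 (pull j.+1) s = delta (pull j) s.
Proof.
move=> gs; rewrite (alt_op_pull _ _ gs) cochain_rec ?delta_map //.
by case/and3P: gs => /eqP ss _ _; rewrite size_map.
Qed.

Lemma sum_const0 (u : G) : \sum_(a : G) u = 0.
Proof.
rewrite sumr_const card_ord -mulr_natr Zp_nat.
by rewrite (_ : inZp _ = 0) ?mulr0 //; apply: val_inj; rewrite /= modnn.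
Qed.

(* For odd [j] the two families of values differ by a constant on [Z_p], and a
   constant sums to [0] over [Z_p]. *)
Lemma chain_eval_pull j : (j < n)%N ->
  chain_eval j (norm_op (@sv_act p' n) (pull j)) = 1.
Proof.
elim: j => [|j IH] jn.
  have gs := good1 p' jn.
  rewrite /= -[norm_op _ _ _]/(alt_op _ 0 _ _) (alt_op_pull _ _ gs).
  exact: cochain0.
have jn' := ltnW jn; rewrite -(IH jn').
have [oj|ej] := boolP (odd j.+1); last first.
  have := chain_eval_delta (pull j) jn'; rewrite /alt_op (negPf ej) => <-.
  apply: eq_chain_eval => // s gs.
  by rewrite -pull_rec // /alt_op (negPf ej).
rewrite /norm_op !chain_eval_sum //; apply/eqP; rewrite -subr_eq0 -sumrB; apply/eqP.
pose u a := chain_eval j.+1 (twist (@sv_act p' n) a (pull j.+1)) -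
            chain_eval j (twist (@sv_act p' n) a (pull j)).
(* By Stokes' formula for the twist of [pull j] by [a], the differences between the rotations [a]
   and [a + 1] agree in both dimensions. *)
have uS a : u (a + 1) = u a.
  have twS k t : twist (@sv_act p' n) a (pull k) (map (sv_act 1) t) =
      twist (@sv_act p' n) (a + 1) (pull k) t.
    by apply: twistD; apply: sv_actD.
  have := chain_eval_delta (twist (@sv_act p' n) a (pull j)) jn'.
  rewrite {1}/alt_op oj (@eq_chain_eval _ _ j.+1 _ (fun s =>
      twist (@sv_act p' n) a (pull j.+1) s -
      twist (@sv_act p' n) (a + 1) (pull j.+1) s)) // => [|s gs]; last first.
    rewrite /twist delta_map -pull_rec ?good_act // /alt_op oj /diff_op /twist.
    rewrite -map_comp; congr (_ - pull _ _); apply: eq_map => X /=.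
    by rewrite sv_actD addrC.
  rewrite (@eq_chain_eval _ _ j _ (fun s =>
      twist (@sv_act p' n) a (pull j) s -
      twist (@sv_act p' n) (a + 1) (pull j) s)) // => [|s gs]; last first.
    by rewrite /diff_op -twS.
  by rewrite !chain_evalB // /u => /eqP; rewrite subr_eq => /eqP ->; ring.
rewrite -[RHS](sum_const0 (u 0)); apply: eq_bigr => a _.
rewrite -/(u a) -[a]natr_Zp; elim: (a : nat) => //= m IHm.
by rewrite -natr1 uS.
Qed.

(** If all neighbouring labels differed, every step would raise the level, giving more than [D]
    levels among [1, ..., D]. *)
Lemma long_path_degenerate X s : X != sv0 -> path (@sv_le p' n) X s ->
  all (fun Y => Y != sv0) s -> (D <= size s)%N -> degenerate (map label (X :: s)).
Proof.
move=> nX pXs ns Ds; apply/negP => H.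
suff : (level X + size s <= D)%N by have := level_gt0 nX; lia.
elim: s X {Ds} nX pXs ns H => [|Y s IH] X nX /=.
  by rewrite addn0 => *; apply: level_leD.
move=> /andP[XY pYs] /andP[nY ns] /andP[lXY lYs].
have := IH Y nY pYs ns lYs; have := level_mono nX XY.
rewrite leq_eqVlt => /orP[/eqP e|]; last lia.
by rewrite (label_level nX XY e) eqxx in lXY.
Qed.

Lemma tucker : (n <= D)%N.
Proof.
rewrite leqNgt; apply/negP => Dn; have n0 : (0 < n)%N by lia.
have n1 : (n.-1 < n)%N by lia.
have := chain_eval_pull n1; rewrite (@eq_chain_eval _ _ _ _ (fun _ => 0)) //.
  by rewrite chain_eval0 // => /eqP; rewrite eq_sym oner_eq0.
rewrite prednK // => s gs; apply: big1 => a _; have := good_act a gs.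
rewrite /twist; case: map => [|X t]; first by move=> /and3P[/eqP /= e]; lia.
move=> /and3P[/eqP /= st /andP[_ pt] /andP[/andP[nX _] gt]].
apply/normalized_cochain/long_path_degenerate => //; last by lia.
by apply: sub_all gt => Y /andP[].
Qed.
End Tucker.

(** * Equivariant labels by orbit representatives *)

Section EquivariantLabel.
Variables (p' : nat) (F : finType).
Notation G := 'I_p'.+2.
Implicit Types (A B : {ffun G -> F}) (a b t u : G).

Definition rotf a A : {ffun G -> F} := [ffun t => A (t - a)].

Lemma rotf0 A : rotf 0 A = A.
Proof. by apply/ffunP => t; rewrite ffunE subr0. Qed.

Lemma rotfD a b A : rotf a (rotf b A) = rotf (a + b) A.
Proof. by apply/ffunP => t; rewrite !ffunE opprD addrA. Qed.

(** As [p] is prime, [a] is invertible, so [t - u] is a multiple of [a]. *)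
Lemma rotf_fixed a A : prime p'.+2 -> a != 0 -> rotf a A = A -> forall t u, A t = A u.
Proof.
move=> pp a0 /ffunP fixA t u.
have fixn m v : A (v - a *+ m) = A v.
  elim: m => [|m IH]; first by rewrite mulr0n subr0.
  by rewrite mulrSr opprD addrA -[RHS]IH -[RHS]fixA ffunE.
have Ua : (a : 'Z_p'.+2) \is a GRing.unit.
  rewrite -[a]natr_Zp unitZpE // prime_coprime // gtnNdvd //.
  by rewrite lt0n; apply: contraNneq a0 => a0; apply/eqP/val_inj.
have <- := fixn ((t - u) / (a : 'Z_p'.+2) : G) t; congr (A _).
by rewrite -mulr_natr natr_Zp mulrC divrK // opprB addrC subrK.
Qed.

Definition orbit_pred A := fun B => [exists a, B == rotf a A].
Definition orbit_rep A := choose (orbit_pred A) A.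
(** The default [0] is never taken: every family is a rotation of its representative. *)
Definition rot_label A : G := odflt 0 [pick a | A == rotf a (orbit_rep A)].

Lemma orbit_pred_refl A : orbit_pred A A.
Proof. by apply/existsP; exists 0; rewrite rotf0. Qed.

Lemma orbit_rep_rot a A : orbit_rep (rotf a A) = orbit_rep A.
Proof.
have E : orbit_pred (rotf a A) =1 orbit_pred A.
  move=> B; apply/existsP/existsP => -[b /eqP ->].
    by exists (b + a); rewrite rotfD.
  by exists (b - a); rewrite rotfD subrK.
rewrite /orbit_rep (eq_choose E); apply: choose_id; last exact: orbit_pred_refl.
by rewrite -E; apply: orbit_pred_refl.
Qed.

Lemma rot_labelP A : A = rotf (rot_label A) (orbit_rep A).
Proof.
rewrite /rot_label; case: pickP => [a /eqP //|H].
have /existsP[a /eqP e] := chooseP (orbit_pred_refl A).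
by move: (H (- a)); rewrite /orbit_rep e rotfD addNr rotf0 eqxx.
Qed.

(** Otherwise a nonzero rotation would fix the representative, and the family would be constant. *)
Lemma rot_label_rot a A : prime p'.+2 -> ~ (forall t u, A t = A u) ->
  rot_label (rotf a A) = rot_label A + a.
Proof.
move=> pp ncA; have := rot_labelP (rotf a A); rewrite orbit_rep_rot {1}(rot_labelP A).
set R := orbit_rep A; set l0 := rot_label A; set l1 := rot_label _; rewrite rotfD => e.
apply/eqP; rewrite -subr_eq0; apply: contra_notT ncA => nz.
have cR : forall t u, R t = R u.
  by apply: (rotf_fixed pp nz); rewrite addrC -rotfD -e rotfD [a + l0]addrC addNr rotf0.
by move=> t u; rewrite (rot_labelP A) !ffunE; apply: cR.
Qed.

End EquivariantLabel.

(** * Total sizes of set families indexed by [Z_p] *)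

Section Families.
Variables (p' : nat) (F : finType).
Notation G := 'I_p'.+2.
Implicit Types (A B : {ffun G -> {set F}}).

Lemma sum_card_mono A B : (forall t, A t \subset B t) ->
  (\sum_t #|A t| <= \sum_t #|B t|)%N.
Proof. by move=> AB; apply: leq_sum => t _; apply: subset_leq_card. Qed.

Lemma sum_card_inj A B : (forall t, A t \subset B t) ->
  \sum_t #|A t| = \sum_t #|B t| -> A = B.
Proof.
move=> AB; have H t : true -> (#|A t| <= #|B t| ?= iff (A t == B t))%N.
  by move=> _; apply: subset_leqif_cards.
move/eqP; rewrite (eq_leqif (leqif_sum H)) => /forallP E.
by apply/ffunP => t; apply/eqP/E.
Qed.

Lemma nonconstant_family A : (forall x, exists t, x \notin A t) ->
  (exists t, A t != set0) -> ~ (forall t u, A t = A u).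
Proof.
move=> H [t /set0Pn[x xt]] /(_ t) cA.
by have [u] := H x; rewrite -cA xt.
Qed.

(** Double counting: each [x] lies in at most [p - 1] of the [p] sets. *)
Lemma sum_card_le A : (forall x, exists t, x \notin A t) ->
  (\sum_t #|A t| <= #|F| * p'.+1)%N.
Proof.
move=> H.
have -> : \sum_t #|A t| = \sum_x #|[set t | x \in A t]|.
  under eq_bigr do rewrite -sum1_card big_mkcond.
  rewrite exchange_big; apply: eq_bigr => x _.
  by rewrite -big_mkcond /= -sum1_card; apply: eq_bigl => t; rewrite inE.
rewrite -sum_nat_const; apply: leq_sum => x _; have [t xt] := H x.
rewrite -ltnS; apply: (@leq_trans #|[set: G]|); last by rewrite cardsT card_ord.
apply: proper_card.
by apply/properP; split; [exact: subsetT | exists t; rewrite ?inE].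
Qed.

End Families.

Lemma card_subset_ex (T : finType) (A : {set T}) k : (k <= #|A|)%N ->
  exists2 B : {set T}, B \subset A & #|B| = k.
Proof.
rewrite cardE => kA; exists [set x in take k (enum A)].
  by apply/subsetP => x; rewrite inE => /mem_take; rewrite mem_enum.
rewrite cardsE (card_uniqP _) ?take_uniq ?enum_uniq //.
by rewrite size_takel.
Qed.

(** * From signed vectors to covers *)

Section Cover.
Variables (q d c p' : nat).
Notation G := 'I_p'.+2.
Notation dset := {S : {set 'I_q} | #|S| == d}.
Notation vec := (signvec p' (q * p'.+1)).
Variable f : dset -> 'I_c.
Hypothesis p_prime : prime p'.+2.
Hypothesis d_lt_q : (d < q)%N.
Hypothesis no_cover : forall S : G -> dset, \bigcup_t val (S t) = [set: 'I_q] ->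
  forall col, exists t, f (S t) != col.
Implicit Types (X Y : vec) (t a : G).

(* Coordinate [i] is one of the [p - 1] copies of the point [i %/ (p - 1)], so a
   point cannot receive all [p] signs. *)
Definition parts X : {ffun G -> {set 'I_q}} :=
  [ffun t => [set x : 'I_q |
    [exists i : 'I_(q * p'.+1), (i %/ p'.+1 == x)%N && (X i == Some t)]]].

Definition colours X : {ffun G -> {set 'I_c}} :=
  [ffun t => [set f A | A : dset & ~: val A \subset parts X t]].

Lemma partsP X t (x : 'I_q) :
  reflect (exists2 i : 'I_(q * p'.+1), (i %/ p'.+1)%N = x & X i = Some t) (x \in parts X t).
Proof.
rewrite ffunE inE; apply: (iffP existsP).
  by move=> [i /andP[/eqP ix /eqP Xi]]; exists i.
by move=> [i ix Xi]; exists i; rewrite ix Xi !eqxx.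
Qed.

Lemma parts_mono X Y t : sv_le X Y -> parts X t \subset parts Y t.
Proof.
move/sv_leP => XY; apply/subsetP => x /partsP[i ix Xi]; apply/partsP.
by exists i => //; case: (XY i); rewrite Xi.
Qed.

Lemma colours_mono X Y t : sv_le X Y -> colours X t \subset colours Y t.
Proof.
move=> XY; rewrite [colours X t]ffunE [colours Y t]ffunE; apply: imsetS.
apply/subsetP => A; rewrite !inE => AX.
exact: subset_trans AX (parts_mono t XY).
Qed.

Lemma parts_act a X : parts (sv_act a X) = rotf a (parts X).
Proof.
apply/ffunP => t; rewrite [RHS]ffunE; apply/setP => x.
apply/partsP/partsP => -[i ix Xi]; exists i => //; move: Xi; rewrite ffunE.
  by case: (X i) => //= u [<-]; rewrite addrK.
by move=> ->; rewrite /= subrK.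
Qed.

Lemma colours_act a X : colours (sv_act a X) = rotf a (colours X).
Proof.
apply/ffunP => t; rewrite [LHS]ffunE parts_act [rotf _ (parts X) t]ffunE.
by rewrite [RHS]ffunE [RHS]ffunE.
Qed.

Lemma parts_cap X (x : 'I_q) : exists t, x \notin parts X t.
Proof.
apply/existsP; rewrite -negb_forall; apply/negP => /forallP H.
have ex t : exists i : 'I_(q * p'.+1), (i %/ p'.+1 == x)%N && (X i == Some t).
  by have /partsP[i ix Xi] := H t; exists i; rewrite ix Xi !eqxx.
pose w t := xchoose (ex t).
have wP t : ((w t %/ p'.+1)%N = x) /\ (X (w t) = Some t).
  by have /andP[/eqP ? /eqP ?] := xchooseP (ex t).
(* The residue names the copy of [x]. A copy carries only one sign, so [p] signs would inject into
   [p - 1] copies. *)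
pose r t : 'I_p'.+1 := inord (w t %% p'.+1)%N.
have r_inj : injective r.
  move=> t u /(congr1 val); rewrite /= !inordK ?ltn_pmod // => e.
  have [wt Xt] := wP t; have [wu Xu] := wP u.
  have ew : w t = w u.
    by apply: val_inj; rewrite /= (divn_eq (w t) p'.+1) wt e -wu -divn_eq.
  by move: Xu; rewrite -ew Xt => -[].
by have := leq_card r r_inj; rewrite !card_ord ltnn.
Qed.

Lemma parts_neq0 X : X != sv0 p' _ -> exists t, parts X t != set0.
Proof.
move=> nX; have /existsP[i] : [exists i, X i != None].
  apply: contraNT nX; rewrite negb_exists => /forallP H; apply/eqP/ffunP => i.
  by apply/eqP; rewrite ffunE -[_ == _]negbK.
case Xi: (X i) => [t|] // _; have iq : (i %/ p'.+1 < q)%N by rewrite ltn_divLR.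
by exists t; apply/set0Pn; exists (Ordinal iq); apply/partsP; exists i.
Qed.

(** Any [q - d] points of the part would form the complement of a [d]-set, whose colour would be
    recorded. *)
Lemma colours_eq0 X t : colours X t = set0 -> (#|parts X t| <= (q - d).-1)%N.
Proof.
move=> c0; rewrite leqNgt; apply/negP => kT.
have [|B BT cB] := @card_subset_ex _ (parts X t) (q - d); first by lia.
have cB' : #|~: B| == d by rewrite cardsCs setCK cB card_ord; apply/eqP; lia.
suff : f (Sub (~: B) cB') \in colours X t by rewrite c0 inE.
by rewrite ffunE; apply: imset_f; rewrite inE SubK setCK.
Qed.

(** A colour present for every [t] comes with [d]-sets of that colour whose complements lie in the
    parts; the parts have no common point, so these sets would form a cover. *)
Lemma colours_cap X (col : 'I_c) : exists t, col \notin colours X t.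
Proof.
apply/existsP; rewrite -negb_forall; apply/negP => /forallP H.
have ex t : exists A : dset, (~: val A \subset parts X t) && (f A == col).
  by have := H t; rewrite ffunE => /imsetP[A]; rewrite inE => AX ->; exists A; rewrite AX eqxx.
pose S t := xchoose (ex t).
have SP t : (~: val (S t) \subset parts X t) /\ f (S t) = col.
  by have /andP[? /eqP ?] := xchooseP (ex t).
have [|t] := @no_cover S _ col; last by rewrite (SP t).2 eqxx.
apply/setP => x; rewrite inE; apply/bigcupP; have [t xt] := parts_cap X x.
exists t => //; apply: contraNT xt => xt.
by apply: (subsetP (SP t).1); rewrite inE.
Qed.

(* [high X] means that some part contains the complement of a [d]-set. *)
Definition high X := [exists t, colours X t != set0].

(** The offset bounds the total size of the parts of a vector that is not high, so high vectors lie
    strictly above all others. *)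
Definition level X : nat :=
  (if high X then p'.+2 * (q - d).-1 + \sum_t #|colours X t| else \sum_t #|parts X t|)%N.

Definition label X : G :=
  if high X then rot_label (colours X) else rot_label (parts X).

Lemma high_act a X : high (sv_act a X) = high X.
Proof.
rewrite /high colours_act; apply/existsP/existsP => -[t].
  by rewrite ffunE => H; exists (t - a).
by move=> H; exists (t + a); rewrite ffunE addrK.
Qed.

Lemma high_mono X Y : sv_le X Y -> high X -> high Y.
Proof.
move=> XY /existsP[t /set0Pn[x xX]]; apply/existsP; exists t; apply/set0Pn.
by exists x; apply: (subsetP (colours_mono t XY)).
Qed.

Lemma sum_card_gt0 (F : finType) (A : {ffun G -> {set F}}) :
  (exists t, A t != set0) -> (0 < \sum_t #|A t|)%N.
Proof. by move=> [t]; rewrite -card_gt0 (bigD1 t) //= addn_gt0 => ->. Qed.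

Lemma level_low X : ~~ high X -> (level X <= p'.+2 * (q - d).-1)%N.
Proof.
move=> lX; rewrite /level (negPf lX); move: lX; rewrite negb_exists => /forallP H.
rewrite -[X in (_ <= X * _)%N]card_ord -sum_nat_const; apply: leq_sum => t _.
by apply/colours_eq0/eqP; rewrite -[_ == _]negbK.
Qed.

Lemma level_high X : high X -> (p'.+2 * (q - d).-1 < level X)%N.
Proof.
move=> hX; rewrite /level hX -[X in (X < _)%N]addn0 ltn_add2l.
exact/sum_card_gt0/existsP.
Qed.

Lemma cover_arith : (q * p'.+1 <= p'.+2 * (q - d).-1 + c * p'.+1)%N.
Proof.
apply: (@tucker _ _ level label) => [X Y nX XY|X Y nX XY|a X nX|X nX|X nX].
- have [hX|lX] := boolP (high X).
    rewrite /level hX (high_mono XY hX) leq_add2l sum_card_mono // => t.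
    exact: colours_mono.
  have [/level_high hY|lY] := boolP (high Y).
    exact: leq_trans (level_low lX) (ltnW hY).
  by rewrite /level (negPf lX) (negPf lY) sum_card_mono // => t; apply: parts_mono.
- have [hX|lX] := boolP (high X).
    rewrite /level /label hX (high_mono XY hX) => /addnI e.
    by rewrite (sum_card_inj _ e) // => t; apply: colours_mono.
  have [/level_high hY|lY] := boolP (high Y).
    by move=> e; exfalso; have := level_low lX; lia.
  rewrite /level /label (negPf lX) (negPf lY) => e.
  by rewrite (sum_card_inj _ e) // => t; apply: parts_mono.
- rewrite /label high_act colours_act parts_act; case: ifP => [/existsP hX|_].
    by apply: rot_label_rot => //; apply: nonconstant_family => //; apply: colours_cap.
  apply: rot_label_rot => //; apply: nonconstant_family; first exact: parts_cap.
  exact: parts_neq0.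
- have [/level_high|/negPf lX] := boolP (high X).
    exact: leq_ltn_trans.
  by rewrite /level lX sum_card_gt0 //; apply: parts_neq0.
have [hX|/level_low lX] := boolP (high X); last first.
  exact: leq_trans lX (leq_addr _ _).
rewrite /level hX leq_add2l.
by have := sum_card_le (colours_cap X); rewrite card_ord.
Qed.

End Cover.

Local Close Scope ring_scope.

Lemma leq_ceil_div a b p : 0 < b -> ceil_div a b <= p -> a <= p * b.
Proof.
by move=> b0; rewrite /ceil_div -ltnS ltn_divLR // mulSn; lia.
Qed.

Theorem theorem2p6 (q d c p : nat) :
  1 <= c -> c <= d -> d <= q ->
  is_least_prime_geq p (ceil_div (q - c + 1) (d - c + 1)) ->
  forall f : dsubset q d -> 'I_c, has_cover q d c p f.
Proof.
move=> c1 cd dq [pp [ple _]] f; have {}ple := leq_ceil_div (ltn_addl _ (ltnSn 0)) ple.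
case: p pp ple => [|[|p']] // pp ple.
(* For [d = q] the full set, repeated [p] times, is a cover. *)
have [dltq|qled] := ltnP d q; last first.
  have cT : #|[set: 'I_q]| == d by rewrite cardsT card_ord eqn_leq dq qled.
  exists (fun=> exist _ setT cT); split; last by exists (f (exist _ setT cT)).
  by apply/setP => x; rewrite inE; apply/bigcupP; exists ord0.
(* With finite functions the existence of a cover is a boolean, so one can argue by cases. *)
pose good_cover (S : {ffun 'I_p'.+2 -> {S : {set 'I_q} | #|S| == d}}) :=
  (\bigcup_t val (S t) == [set: 'I_q]) && [exists col, forall t, f (S t) == col].
have [/existsP[S /andP[/eqP US /existsP[col /forallP fS]]]|nocov] :=
    boolP [exists S, good_cover S].
  by exists S; split=> //; exists col => t; apply/eqP.
have := @cover_arith q d c p' f pp dltq.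
suff no_cover : forall S : 'I_p'.+2 -> {S : {set 'I_q} | #|S| == d},
    \bigcup_t val (S t) = [set: 'I_q] -> forall col, exists t, f (S t) != col.
  (* [le_q] rearranges to [p (d - c + 1) <= q - c], whereas [ple] says
     [q - c + 1 <= p (d - c + 1)]. *)
  move=> /(_ no_cover) le_q; exfalso; nia.
move=> S US col; apply/existsP; rewrite -negb_forall; apply: contra nocov => H.
apply/existsP; exists [ffun t => S t]; apply/andP; split.
  by apply/eqP; rewrite -US; apply: eq_bigr => t _; rewrite ffunE.
apply/existsP; exists col; apply/forallP => t; rewrite ffunE.
exact: (forallP H).
Qed.
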